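(* Let $(R,\mathfrak{m})$ be a local ring of prime characteristic $p>0$ with $\dim R>0$, let $M$ be a finitely generated $R$-module, and let $s>0$ be a real number. Let $\mathfrak{m}\ltimes\mathfrak{m}M=\{(a,x):a\in\mathfrak{m},\ x\in\mathfrak{m}M\}$, an ideal of the idealization $R\ltimes M$. Then $$e_s(R\ltimes M)\leq e_s(\mathfrak{m}\ltimes\mathfrak{m}M)=e_s(R)+e_s(M).$$ In particular, if $\dim(M)<\dim(R)$, then $$e_s(R\ltimes M)\leq e_s(R).$$ Here $e_s(R\ltimes M)$ and $e_s(\mathfrak{m}\ltimes\mathfrak{m}M)$ are taken over the ring $R\ltimes M$, and $e_s(R)$, $e_s(M)$ over $R$.
   Context: All rings are commutative, Noetherian, local, with identity. Idealization: for a ring $R$ and an $R$-module $M$, $R\ltimes M$ is the set of pairs $(r,m)$, $r\in R$, $m\in M$, with componentwise addition and multiplication $(r,m)(r',m')=(rr',rm'+r'm)$. If $(R,\mathfrak{m})$ is local and $M$ is finitely generated, then $R\ltimes M$ is local with maximal ideal $\mathfrak{m}\ltimes M$, has the same characteristic as $R$, and $\dim(R\ltimes M)=\dim R$. $s$-multiplicity: let $(A,\mathfrak{n})$ be a local ring of prime characteristic $p>0$ and dimension $d>0$, let $I,J$ be $\mathfrak{n}$-primary ideals, $N$ a finitely generated $A$-module, $s>0$ real. Put $$h_s(I,J;N)=\lim_{e\to\infty}\frac{\ell_A\big(N/(I^{\lceil sp^e\rceil}+J^{[p^e]})N\big)}{p^{ed}},\qquad d=\dim A,$$ where $\ell_A$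 is length and $J^{[p^e]}$ is the ideal generated by the $p^e$-th powers of elements of $J$ (the limit is known to exist), and $$e_s(I,J;N)=\frac{h_s(I,J;N)}{\mathcal{H}_s(d)},\qquad \mathcal{H}_s(d)=\sum_{i=0}^{\lfloor s\rfloor}\frac{(-1)^i}{d!}\binom{d}{i}(s-i)^d .$$ Abbreviations: for an $\mathfrak{n}$-primary ideal $I$ of $A$, $e_s(I):=e_s(I,I;A)$; for a finitely generated $A$-module $N$ (including $N=A$), $e_s(N):=e_s(\mathfrak{n},\mathfrak{n};N)$. *)

(* Defs.v *)
From HB Require Import structures.
From mathcomp Require Import all_boot all_order all_algebra.
From mathcomp Require Import all_classical all_reals all_analysis.

Set Implicit Arguments.
Unset Strict Implicit.
Unset Printing Implicit Defensive.

Import Order.TTheory GRing.Theory Num.Theory.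
Import numFieldNormedType.Exports.

Local Open Scope classical_set_scope.
Local Open Scope ring_scope.
Local Open Scope quotient_scope.

(* Submodules are [set]s satisfying [submod_closed]; the ideals of a ring A are
   the submodules of the regular module A^o.  The library predicate
   [idealr_closed] requires in addition that the ideal be proper. *)

Section Submodules.
Context {A : comNzRingType} {V : lmodType A}.

Definition submodule (S : set V) : Prop := submod_closed [in S].

Definition submod_span (X : set V) : set V := smallest submodule X.

Definition in_span (X : set V) : {pred V} := fun x => x \in submod_span X.

Lemma in_span_submod_closed X : submod_closed (in_span X).
Proof.
split=> [|a u v]; rewrite /in_span !inE.
  by move=> S [[S0 _] _]; rewrite inE in S0.
move=> Xu Xv S SX; have [[_ Slin] _] := SX.
rewrite -in_setE; apply: Slin; rewrite inE.
  exact: Xu.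
exact: Xv.
Qed.

HB.instance Definition _ (X : set V) :=
  GRing.isSubmodClosed.Build A V (in_span X) (in_span_submod_closed X).

Definition fin_gen : Prop := exists s : seq V, submod_span [set` s] = [set: V].

Definition ideal_mul (I : set A^o) (S : set V) : set V :=
  submod_span [set y | exists a x, [/\ I a, S x & y = a *: x]].

End Submodules.

Arguments fin_gen {A} V.

(* The quotient of V by the submodule generated by X; it is V / X when X is
   already a submodule. *)
Section QuotientModule.
Context {A : comNzRingType} (V : lmodType A) (X : set V).

Definition quotmod := Quotient.quot (in_span X).
HB.instance Definition _ := GRing.Zmodule.on quotmod.

Definition quotmod_scale (a : A) (u : quotmod) : quotmod :=
  \pi_(Quotient.quot (in_span X)) (a *: repr u).

Lemma pi_scale a x :
  \pi_(Quotient.quot (in_span X)) (a *: x)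
    = quotmod_scale a (\pi_(Quotient.quot (in_span X)) x).
Proof.
apply/eqP; rewrite /quotmod_scale -Quotient.idealrBE -scalerBr.
by apply: rpredZ; rewrite Quotient.idealrBE reprK.
Qed.

Lemma quotmod_scaleA a b u :
  quotmod_scale a (quotmod_scale b u) = quotmod_scale (a * b) u.
Proof. by elim/quotW: u => x; rewrite -(pi_scale b x) -(pi_scale a) -pi_scale scalerA. Qed.

Lemma quotmod_scale1 : left_id 1 quotmod_scale.
Proof. by elim/quotW=> x; rewrite -pi_scale scale1r. Qed.

Lemma quotmod_scaleDr : right_distributive quotmod_scale +%R.
Proof.
move=> a; elim/quotW=> x; elim/quotW=> y.
by rewrite -raddfD -!(pi_scale a) -raddfD scalerDr.
Qed.

Lemma quotmod_scaleDl u : {morph quotmod_scale^~ u : a b / a + b}.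
Proof.
by move=> a b; elim/quotW: u => x; rewrite -!(pi_scale _ x) -raddfD scalerDl.
Qed.

HB.instance Definition _ := GRing.Zmodule_isLmodule.Build A quotmod
  quotmod_scaleA quotmod_scale1 quotmod_scaleDr quotmod_scaleDl.

End QuotientModule.

(* The supremum of the n such that there is a strictly increasing chain
   c 0 < c 1 < ... < c n of sets satisfying P; it is -oo if P is empty. *)
Definition chain_sup (K : realType) (T : Type) (P : set (set T)) : \bar K :=
  ereal_sup [set n%:R%:E | n in [set n : nat | exists c : nat -> set T,
    (forall i, (i <= n)%N -> P (c i)) /\
    (forall i, (i < n)%N -> c i `<` c i.+1)]].

Definition module_length (K : realType) (A : comNzRingType) (V : lmodType A) : \bar K :=
  chain_sup K (submodule : set (set V)).

Section Rings.
Variable A : comNzRingType.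
Implicit Types (I J P m : set A^o).

Definition prime_ideal P : Prop :=
  idealr_closed [in (P : set A)] /\ prime_idealr_closed [in (P : set A)].

Definition maximal_ideal m : Prop :=
  idealr_closed [in (m : set A)] /\
  forall I, idealr_closed [in (I : set A)] -> m `<=` I -> I = m.

Definition local_ring : Prop := exists! m, maximal_ideal m.

(* Meaningful for a local ring, in which there is exactly one candidate. *)
Definition max_ideal : set A^o := xget set0 [set m | maximal_ideal m].

Definition noetherian : Prop := forall I, submodule I ->
  exists s : seq A^o, submod_span [set` s] = I.

Definition krull_dim (K : realType) : \bar K := chain_sup K prime_ideal.

Definition annihilator (V : lmodType A) : set A^o :=
  [set a | forall x : V, a *: x = 0].

(* dim V = dim (A / Ann V), in terms of primes of A; it is -oo if V = 0. *)
Definition module_dim (K : realType) (V : lmodType A) : \bar K :=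
  chain_sup K [set P | prime_ideal P /\ annihilator V `<=` P].

Definition ideal_add I J : set A^o :=
  [set z | exists x y, [/\ I x, J y & z = x + y]].

Definition ideal_exp I n : set A^o := iter n (ideal_mul I) setT.

Definition frobenius_power J q : set A^o :=
  submod_span [set y : A^o | exists2 x : A, J x & y = x ^+ q].

End Rings.

Arguments max_ideal A : clear implicits.
Arguments krull_dim A K : clear implicits.

Section SMultiplicity.
Context {K : realType} {A : comNzRingType}.
Implicit Types (I J : set A^o) (N : lmodType A).

Definition hs_ideal (p : nat) (s : K) I J (e : nat) : set A^o :=
  ideal_add (ideal_exp I `|Num.ceil (s * (p ^ e)%:R)|%N)
            (frobenius_power J (p ^ e)).

Definition hs_length (p : nat) (s : K) I J N (e : nat) : \bar K :=
  module_length K (quotmod (ideal_mul (hs_ideal p s I J e) [set: N])).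

Definition normalizer (s : K) (d : nat) : K :=
  \sum_(0 <= i < (Num.truncn s).+1)
    (-1) ^+ i / d`!%:R * 'C(d, i)%:R * (s - i%:R) ^+ d.

(* [is_es p s I J N x] means e_s(I, J; N) = x, in the same way as
   [derivable_pt_lim] or [is_derive] express the value of a derivative: the
   limit h_s(I, J; N) is specified, rather than given a default value where it
   would fail to exist. *)
Definition is_es (p : nat) (s : K) I J N (x : K) : Prop :=
  exists d : nat, exists h : K,
    [/\ krull_dim A K = d%:R%:E,
        (hs_length p s I J N e * ((p ^ (e * d))%:R^-1)%:E)%E @[e --> \oo] --> h%:E
      & x = h / normalizer s d].

Definition is_es_ideal (p : nat) (s : K) I (x : K) : Prop :=
  is_es p s I I A^o x.

Definition is_es_module (p : nat) (s : K) N (x : K) : Prop :=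
  is_es p s (max_ideal A) (max_ideal A) N x.

End SMultiplicity.

Section Idealization.
Variables (R : comNzRingType) (M : lmodType R).

Definition idealization : Type := (R * M)%type.

HB.instance Definition _ := GRing.Zmodule.copy idealization (R * M)%type.

Definition idealization_one : idealization := (1, 0).

Definition idealization_mul (u v : idealization) : idealization :=
  (u.1 * v.1, u.1 *: v.2 + v.1 *: u.2).

Lemma idealization_mulA : associative idealization_mul.
Proof.
move=> u v w; rewrite /idealization_mul /= mulrA; congr pair.
by rewrite !scalerDr !scalerA addrA [w.1 * u.1]mulrC [w.1 * v.1]mulrC.
Qed.

Lemma idealization_mulC : commutative idealization_mul.
Proof. by move=> u v; rewrite /idealization_mul mulrC addrC. Qed.

Lemma idealization_mul1 : left_id idealization_one idealization_mul.
Proof.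
by move=> [a x]; rewrite /idealization_mul /= mul1r scale1r scaler0 addr0.
Qed.

Lemma idealization_mulDl : left_distributive idealization_mul +%R.
Proof.
move=> u v w; rewrite /idealization_mul /=; congr pair; first exact: mulrDl.
by rewrite scalerDl scalerDr addrACA.
Qed.

Lemma idealization_one_neq0 : idealization_one != 0.
Proof. by apply/negP => /eqP [] /eqP; rewrite oner_eq0. Qed.

HB.instance Definition _ := GRing.Zmodule_isComNzRing.Build idealization
  idealization_mulA idealization_mulC idealization_mul1 idealization_mulDl
  idealization_one_neq0.

(* For an ideal I and a submodule S this is I |x S, an ideal of R |x M as soon
   as I M is contained in S. *)
Definition idealization_ideal (I : set R^o) (S : set M) : set idealization^o :=
  [set u : idealization | I u.1 /\ S u.2].

End Idealization.

Arguments idealization R M : clear implicits.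

(* Main.v *)
(* Write A = R |x M, I = m |x mM and J_e = m^ceil(s p^e) + m^[p^e].  The ideal I is
   the extension m A, and in characteristic p one has (a, x)^(p^e) = (a^(p^e), 0)
   for e > 0, so that I^ceil(s p^e) + I^[p^e] = J_e |x J_e M.  The submodule 0 |x M
   splits the colength of this ideal as l(R / J_e) + l(M / J_e M), and
   dim A = dim R, which gives e_s(I) = e_s(R) + e_s(M).  Since I lies in the
   maximal ideal of A and the normalizer is nonnegative, e_s(A) <= e_s(I).

   If dim M < d = dim R, then l(M / J_e M) is at most a constant times
   l(R / (Ann M + J_e)), which by Noetherian induction is O(p^(e (d - 1))) because
   J_e contains x^(p^e) for each x in m; hence e_s(M) = 0.

   Lengths are suprema of lengths of chains of submodules and may be infinite. *)
Require Import Defs.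
From mathcomp Require Import all_boot all_order all_algebra.
From mathcomp Require Import all_classical all_reals all_analysis.
From mathcomp Require Import ring.

Set Implicit Arguments.
Unset Strict Implicit.
Unset Printing Implicit Defensive.

Import Order.TTheory GRing.Theory Num.Theory.

Local Open Scope classical_set_scope.
Local Open Scope ring_scope.

(** * Strict chains of sets and the suprema of their lengths *)

Section Chains.
Context {K : realType} {T U : Type}.
Implicit Types (P Q : set (set T)) (E F : set T).

(** Keeps the top [E] of the chain in view, so that a chain can be extended upwards one set at a
    time. *)
Definition chain_to P n E : Prop := exists c : nat -> set T,
  [/\ forall i, (i <= n)%N -> P (c i),
      forall i, (i < n)%N -> c i `<` c i.+1 & c n = E].

Lemma chain_to0 P E : P E -> chain_to P 0 E.
Proof. by move=> PE; exists (fun=> E). Qed.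

Lemma chain_to_mem P n E : chain_to P n E -> P E.
Proof. by case=> c [Pc _ <-]; exact: Pc. Qed.

Lemma chain_toS P n E F : chain_to P n E -> P F -> E `<` F ->
  chain_to P n.+1 F.
Proof.
move=> [c [Pc c_lt <-]] PF ltF.
exists (fun i => if (i <= n)%N then c i else F); split=> [i _|i|].
- by case: ifP => // ?; exact: Pc.
- by rewrite ltnS /=; case: ltngtP => // [lt_in|->] _; first exact: c_lt.
- by rewrite ltnn.
Qed.

Lemma chain_to_sub P Q n E : P `<=` Q -> chain_to P n E -> chain_to Q n E.
Proof. by move=> PQ [c [Pc ? ?]]; exists c; split=> // i /Pc/PQ. Qed.

Lemma chain_to_cons P Q n E F :
  P E -> (forall G, Q G -> P G /\ E `<` G) -> chain_to Q n F ->
  chain_to P n.+1 F.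
Proof.
move=> PE QP [c [Qc c_lt <-]]; exists (fun i => if i is j.+1 then c j else E).
split=> // [[|i] //|[|i]] le_in; last exact: c_lt.
  by have [] := QP _ (Qc i le_in).
by have [] := QP _ (Qc 0%N isT).
Qed.

Lemma chain_sup_ubP P (z : \bar K) :
  (chain_sup K P <= z)%E <->
  (forall n E, chain_to P n E -> (n%:R%:E <= z)%E).
Proof.
split=> [/ereal_supP ub n E [c [Pc c_lt _]]|ub].
  by apply: ub; exists n => //; exists c.
by apply/ereal_supP => _ [n [c [Pc c_lt]] <-]; apply: (ub _ (c n)); exists c.
Qed.

Lemma chain_to_le_sup P n E : chain_to P n E ->
  (n%:R%:E <= chain_sup K P)%E.
Proof. exact: (chain_sup_ubP P _).1. Qed.

Lemma chain_sup_ge0 P E : P E -> (0 <= chain_sup K P)%E.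
Proof. by move=> /chain_to0/chain_to_le_sup. Qed.

(** An order embedding carries strict chains to strict chains. Comparisons of lengths and dimensions
    through a correspondence of submodules or primes reduce to this. *)
Lemma chain_sup_le P (Q : set (set U)) (f : set T -> set U) :
  (forall S, P S -> Q (f S)) ->
  (forall S S', P S -> P S' -> f S `<=` f S' <-> S `<=` S') ->
  (chain_sup K P <= chain_sup K Q)%E.
Proof.
move=> PQ f_mono; apply: ereal_sup_le => _ [n [c [Pc c_lt]] <-].
exists n => //; exists (f \o c); split=> [i /Pc/PQ//|i lt_in /=].
have [Pi Pi1] : P (c i) /\ P (c i.+1) by split; apply: Pc => //; exact: ltnW.
have [sub nsub] := c_lt _ lt_in.
by split=> [|/f_mono]; [apply/f_mono | move=> /(_ Pi1 Pi)].
Qed.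

(** Finite elements can be moved across the inequality, so the suprema are taken one set at a time.
    They may be [+oo]; nonemptiness excludes [-oo]. *)
Lemma ereal_supD_le (X Y : set (\bar K)) z : X !=set0 -> Y !=set0 ->
  (forall x, X x -> x \is a fin_num) -> (forall y, Y y -> y \is a fin_num) ->
  (forall x y, X x -> Y y -> (x + y <= z)%E) ->
  (ereal_sup X + ereal_sup Y <= z)%E.
Proof.
move=> [x0 Xx0] [y0 Yy0] Xfin Yfin XYz.
have step y : Y y -> (ereal_sup X + y <= z)%E.
  move=> Yy; rewrite -leeBrDr ?Yfin//; apply/ereal_supP => x Xx.
  by rewrite leeBrDr ?Yfin//; exact: XYz.
have leX : (x0 <= ereal_sup X)%E by exact: ereal_sup_ubound.
case: (ereal_sup X) step leX => [r||] step leX.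
- by rewrite -leeBrDl//; apply/ereal_supP => y /step; rewrite leeBrDl.
- move: (step _ Yy0); rewrite addye ?leye_eq => [/eqP->|]; first exact: leey.
  by have := Yfin _ Yy0; case: (y0).
- by have := Xfin _ Xx0; move: leX; rewrite leeNy_eq => /eqP->.
Qed.

Lemma chain_supD_le (P Q : set (set T)) (z : \bar K) E F : P E -> Q F ->
  (forall n m E F, chain_to P n E -> chain_to Q m F -> ((n + m)%:R%:E <= z)%E) ->
  (chain_sup K P + chain_sup K Q <= z)%E.
Proof.
move=> PE QF PQz; apply: ereal_supD_le.
- by exists 0%:R%:E, 0%N => //; exists (fun=> E).
- by exists 0%:R%:E, 0%N => //; exists (fun=> F).
- by move=> _ [n _ <-].
- by move=> _ [n _ <-].
move=> _ _ [n [c [Pc c_lt]] <-] [m [d [Qd d_lt]] <-].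
by rewrite -EFinD -natrD; apply: (PQz _ _ (c n) (d m)); [exists c | exists d].
Qed.

End Chains.

(** * Submodules, relative length and its additivity *)

Section Submodules.
Context {K : realType} {A : comNzRingType} {V : lmodType A}.
Implicit Types (S X Y Z : set V).

Lemma submoduleP S : submodule S <->
  S 0 /\ forall a u v, S u -> S v -> S (a *: u + v).
Proof.
split=> [[]|[S0 lin]]; first rewrite inE => S0 lin; split=> //.
- by move=> a u v Su Sv; have := lin a u v; rewrite !inE; exact.
- by rewrite inE.
- by move=> a u v; rewrite !inE; exact: lin.
Qed.

Lemma submodule0 S : submodule S -> S 0.
Proof. by case/submoduleP. Qed.

Lemma submoduleZ S a u : submodule S -> S u -> S (a *: u).
Proof. by case/submoduleP => S0 lin Su; rewrite -[_ *: _]addr0; exact: lin. Qed.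

Lemma submoduleD S u v : submodule S -> S u -> S v -> S (u + v).
Proof. by case/submoduleP => S0 lin Su Sv; rewrite -[u]scale1r; exact: lin. Qed.

Lemma submoduleB S u v : submodule S -> S u -> S v -> S (u - v).
Proof.
by move=> sS Su Sv; apply: submoduleD => //; rewrite -scaleN1r; exact: submoduleZ.
Qed.

Lemma submoduleT : submodule [set: V].
Proof. by apply/submoduleP. Qed.

Lemma submodule_span X : submodule (submod_span X).
Proof.
have [X0 Xlin] := in_span_submod_closed X.
split=> [|a u v]; rewrite !inE; first by move: X0; rewrite /in_span inE.
by move=> Xu Xv; have := Xlin a u v; rewrite /in_span !inE; exact.
Qed.

Lemma sub_span X : X `<=` submod_span X.
Proof. exact: sub_smallest. Qed.

Lemma span_sub X S : submodule S -> X `<=` S -> submod_span X `<=` S.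
Proof. by move=> sS XS u; apply. Qed.

Lemma span_id S : submodule S -> submod_span S = S.
Proof. by move=> sS; apply/seteqP; split; [exact: span_sub | exact: sub_span]. Qed.

(* In the module A^o this is [ideal_add], by conversion. *)
Definition sum_set X Y : set V := [set z | exists x y, [/\ X x, Y y & z = x + y]].

Lemma submodule_sum X Y : submodule X -> submodule Y -> submodule (sum_set X Y).
Proof.
move=> sX sY; apply/submoduleP; split.
  by exists 0, 0; rewrite addr0; split=> //; exact: submodule0.
move=> a _ _ [x [y [Xx Yy ->]]] [x' [y' [Xx' Yy' ->]]].
exists (a *: x + x'), (a *: y + y'); split; first 1 last.
- by case/submoduleP: sY => _; exact.
- by rewrite scalerDr addrACA.
- by case/submoduleP: sX => _; exact.
Qed.

Lemma sub_sumr X Y : submodule X -> Y `<=` sum_set X Y.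
Proof. by move=> sX y Yy; exists 0, y; rewrite add0r; split=> //;
  exact: submodule0. Qed.

Lemma sub_suml X Y : submodule Y -> X `<=` sum_set X Y.
Proof. by move=> sY x Xx; exists x, 0; rewrite addr0; split=> //;
  exact: submodule0. Qed.

Lemma sum_sub X Y S : submodule S -> X `<=` S -> Y `<=` S -> sum_set X Y `<=` S.
Proof. by move=> sS XS YS _ [x [y [/XS Sx /YS Sy ->]]]; exact: submoduleD. Qed.

Lemma sum_setS X X' Y Y' : X `<=` X' -> Y `<=` Y' -> sum_set X Y `<=` sum_set X' Y'.
Proof. by move=> XX' YY' _ [x [y [/XX' Sx /YY' Sy ->]]]; exists x, y. Qed.

Lemma submoduleI X Y : submodule X -> submodule Y -> submodule (X `&` Y).
Proof.
move=> /submoduleP[X0 Xl] /submoduleP[Y0 Yl]; apply/submoduleP; split=> //.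
by move=> a u v [Xu Yu] [Xv Yv]; split; [exact: Xl | exact: Yl].
Qed.

Definition between X Z : set (set V) :=
  [set S | [/\ submodule S, X `<=` S & S `<=` Z]].

Lemma between_l X Z : submodule X -> X `<=` Z -> between X Z X.
Proof. by move=> sX XZ; split. Qed.

(* The length of Z / X. *)
Definition rlen X Z : \bar K := chain_sup K (between X Z).

Lemma rlen_ge0 X Z : submodule X -> X `<=` Z -> (0 <= rlen X Z)%E.
Proof. by move=> sX /between_l XZ; exact/chain_sup_ge0/XZ. Qed.

Lemma rlen_sub X X' Z Z' : X' `<=` X -> Z `<=` Z' -> (rlen X Z <= rlen X' Z')%E.
Proof.
move=> X'X ZZ'; apply: (@chain_sup_le _ _ _ _ _ id) => // S [sS XS SZ].
by split=> //; [exact: subset_trans XS | exact: subset_trans ZZ'].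
Qed.

Lemma modular_law Y S S' : submodule S -> submodule S' -> S `<=` S' ->
  S' `&` Y `<=` S -> S' `<=` sum_set S Y -> S' `<=` S.
Proof.
move=> sS sS' SS' meet join u S'u; have [x [y [Sx Yy def_u]]] := join u S'u.
rewrite def_u; apply: submoduleD => //; apply: meet; split=> //.
by rewrite -(addKr x y) -def_u addrC; apply: submoduleB => //; exact: SS'.
Qed.

(* By the modular law, each step of a chain between X and Z is strict either
   after intersecting with Y or after adding Y. *)
Lemma rlenD X Y Z : submodule X -> submodule Y -> submodule Z -> X `<=` Y ->
  Y `<=` Z ->
  rlen X Z = (rlen X Y + rlen Y Z)%E.
Proof.
move=> sX sY sZ XY YZ; have XZ := subset_trans XY YZ.
apply/eqP; rewrite eq_le; apply/andP; split; last first.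
  apply: (chain_supD_le (between_l sX XY) (between_l sY YZ)) =>
    n m E F cE [d [Qd d_lt _]].
  have PE : E `<=` Y by case: (chain_to_mem cE).
  (* The chain [d] is stacked on the one ending in [E], with [E] in place of [d 0]: since [E] lies
     in [Y], hence in [d 0], the strictness of [d] suffices at the seam. *)
  suff dn j : (j <= m)%N -> exists2 G,
    chain_to (between X Z) (n + j) G & G `<=` d j.
    by have [G /chain_to_le_sup] := dn m (leqnn m); exact.
  elim: j => [_|j IH lt_jm].
    rewrite addn0; exists E; last by case: (Qd 0%N) => // _ Yd _;
      exact: subset_trans Yd.
    by apply: chain_to_sub cE => S [sS XS SY]; split=> //; exact: subset_trans YZ.
  have [G cG Gd] := IH (ltnW lt_jm); have [sub nsub] := d_lt _ lt_jm.
  exists (d j.+1) => //; rewrite addnS; apply: (chain_toS cG).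
    by case: (Qd j.+1) => // sd Yd dZ; split=> //; exact: subset_trans Yd.
  by split=> [|/subset_trans/(_ Gd)//]; exact: subset_trans sub.
apply/chain_sup_ubP => n _ [c [Pc c_lt _]].
(* Only an inequality, because one step of [c] may be strict both after intersecting and after
   adding. *)
suff [k [l [le_n ck cl]]] : exists k l, [/\ (n <= k + l)%N,
    chain_to (between X Y) k (c n `&` Y)
    & chain_to (between Y Z) l (sum_set (c n) Y)].
  apply: (@le_trans _ _ (k + l)%:R%:E); first by rewrite lee_fin ler_nat.
  by rewrite natrD EFinD; apply: leeD;
    [exact: chain_to_le_sup ck | exact: chain_to_le_sup cl].
have Pm i : (i <= n)%N -> between X Y (c i `&` Y).
  move=> /Pc[sc Xc cZ]; split; [exact: submoduleI | | by move=> u []].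
  by move=> u Xu; split; [exact: Xc | exact: XY].
have Pj i : (i <= n)%N -> between Y Z (sum_set (c i) Y).
  move=> /Pc[sc Xc cZ]; split; [exact: submodule_sum | exact: sub_sumr |].
  exact: sum_sub.
(* Induction on the position in the chain, its full length [n] staying fixed as the bound. *)
move: {1 3 4 5}n (leqnn n).
elim=> [|i IH] le_in.
  by exists 0%N, 0%N; split=> //; apply: chain_to0; [exact: Pm | exact: Pj].
have [k [l [le_i ck cl]]] := IH (ltnW le_in).
have [sub nsub] := c_lt _ le_in.
have subm : c i `&` Y `<=` c i.+1 `&` Y by move=> u [/sub].
have subj : sum_set (c i) Y `<=` sum_set (c i.+1) Y by exact: sum_setS.
have [eqm|nm] := pselect (c i.+1 `&` Y `<=` c i `&` Y); last first.
  have ck' : chain_to (between X Y) k.+1 (c i.+1 `&` Y)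
    by apply: (chain_toS ck); [exact: Pm |].
  have [eqj|nj] := pselect (sum_set (c i.+1) Y `<=` sum_set (c i) Y).
    exists k.+1, l; split=> //; rewrite ?addSn ?ltnS//.
    by have -> : sum_set (c i.+1) Y = sum_set (c i) Y by apply/seteqP.
  exists k.+1, l.+1; split=> //; first by rewrite addnS addSn ltnW// !ltnS.
  by apply: (chain_toS cl); [exact: Pj |].
have [eqj|nj] := pselect (sum_set (c i.+1) Y `<=` sum_set (c i) Y).
  case: nsub; have [si _ _] := Pc _ (ltnW le_in); have [si1 _ _] := Pc _ le_in.
  apply: (modular_law (Y := Y)) => //; first by move=> u /eqm[].
  by move=> u /(sub_suml sY)/eqj.
exists k, l.+1; split; first by rewrite addnS ltnS.
- by have -> : c i.+1 `&` Y = c i `&` Y by apply/seteqP.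
- by apply: (chain_toS cl); [exact: Pj |].
Qed.

End Submodules.

(** * The length of a quotient module as a relative length *)

Section QuotientLength.
Context {K : realType} {A : comNzRingType} {V : lmodType A}.
Variable X : set V.
Hypothesis sX : submodule X.
Local Open Scope quotient_scope.

Let pi (x : V) : quotmod X := \pi_(Quotient.quot (in_span X)) x.

Lemma quot_eqP x y : pi x = pi y <-> X (x - y).
Proof.
have in_spanE : (x - y \in in_span X) = (x - y \in X).
  by rewrite /in_span -topredE /= span_id.
have := Quotient.idealrBE (in_span X) x y.
rewrite in_spanE => xy; split=> [/eqP|/mem_set]; first by rewrite -xy inE.
by rewrite xy => /eqP.
Qed.

Lemma quot_lin a x y : pi (a *: x + y) = a *: pi x + pi y.
Proof. by rewrite /pi raddfD; congr (_ + _); exact: pi_scale. Qed.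

Lemma quot_surj u : exists x, pi x = u.
Proof. by exists (repr u); rewrite /pi reprK. Qed.

(** The correspondence of submodules: taking preimages and taking images along [pi] both preserve
    and reflect inclusion, and each gives one inequality. *)
Lemma module_length_quotmod : module_length K (quotmod X) = rlen X [set: V].
Proof.
have pi0 : pi 0 = 0 by rewrite /pi raddf0.
apply/eqP; rewrite eq_le; apply/andP; split.
  apply: (@chain_sup_le _ _ _ _ _ (fun T => pi @^-1` T)) => [T sT|T T' _ _].
    split=> // [|x Xx].
      apply/submoduleP; split=> [|a x y Tx Ty] /=; first by rewrite pi0;
        exact: submodule0.
      by rewrite quot_lin; case/submoduleP: sT => _; exact.
    have -> : (pi @^-1` T) x = T (pi x) by [].
    by have -> : pi x = 0; [rewrite -pi0; apply/quot_eqP;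
      rewrite subr0 | exact: submodule0].
  split=> [TT' u|TT' x]; last exact: TT'.
  by have [x <-] := quot_surj u; exact: TT'.
apply: (@chain_sup_le _ _ _ _ _ (fun S => pi @` S)) =>
  [S [sS _ _]|S S' [_ _ _] [sS' XS' _]].
  apply/submoduleP; split=> [|a _ _ [x Sx <-] [y Sy <-]].
    by exists 0 => //; exact: submodule0.
  by exists (a *: x + y); [case/submoduleP: sS => _; exact | exact: quot_lin].
split=> [SS' x Sx|]; last exact: image_subset.
have [|y S'y /esym/quot_eqP/XS'] := SS' (pi x); first by exists x.
by rewrite -{2}[x](subrK y) => ?; exact: submoduleD.
Qed.

End QuotientLength.

(** * Cyclic submodules *)

Section Cyclic.
Context {K : realType} {A : comNzRingType} {V : lmodType A}.
Implicit Types (S T : set V) (b : set A^o).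

Definition line (x : V) : set V := [set a *: x | a in [set: A]].

Lemma submodule_line x : submodule (line x).
Proof.
apply/submoduleP; split; first by exists 0 => //; rewrite scale0r.
move=> a _ _ [c _ <-] [d _ <-]; exists (a * c + d) => //.
by rewrite scalerDl scalerA.
Qed.

Lemma line_id x : line x x.
Proof. by exists 1 => //; rewrite scale1r. Qed.

Lemma line_sub x S : submodule S -> S x -> line x `<=` S.
Proof. by move=> sS Sx _ [a _ <-]; exact: submoduleZ. Qed.

(* (S + A x) / S is isomorphic to A / (S : x). *)
Lemma rlen_line S b x : submodule S -> (forall a, b a -> S (a *: x)) ->
  (rlen (K := K) S (sum_set S (line x)) <= rlen b [set: A^o])%E.
Proof.
move=> sS bxS.
(* A module T between S and S + A x is determined by the colon ideal (T : x), which contains [b]. *)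
apply: (@chain_sup_le _ _ _ _ _ (fun T => [set a : A^o | T (a *: x)])).
  move=> T [sT ST _]; split=> // [|a /bxS/ST//].
  apply/submoduleP; split=> [|a c d Tc Td] /=; first by rewrite scale0r;
    exact: submodule0.
  by rewrite scalerDl -scalerA; case/submoduleP: sT => _; exact.
move=> T T' [sT ST Tx] [sT' ST' T'x]; split=> [TT' u Tu|TT' a /TT'//].
have [y [_ [Sy [a _ <-] def_u]]] := Tx u Tu.
rewrite def_u; apply: submoduleD => //; first exact: ST'.
apply: TT' => /=; have -> : a *: x = u - y by rewrite def_u addrC addKr.
by apply: submoduleB => //; exact: ST.
Qed.

End Cyclic.

(** * Noetherian induction, prime and maximal ideals *)

Section Noetherian.
Context {A : comNzRingType}.
Implicit Types (I J P S m : set A^o).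

(** If the conclusion failed, every bad ideal would lie strictly inside another one, and dependent
    choice would give an infinite ascending chain. Its union is finitely generated, so one term
    already contains it, against strictness. *)
Lemma noetherian_ind (Q : set (set A^o)) : noetherian A ->
  (forall I, submodule I ->
    (forall J, submodule J -> I `<` J -> Q J) -> Q I) ->
  forall I, submodule I -> Q I.
Proof.
move=> noethA step I0 sI0; apply: contrapT => nQI0.
pose bad := {I : set A^o | submodule I /\ ~ Q I}.
have next (x : bad) : {y : bad | sval x `<` sval y}.
  apply: cid; case: x => I [sI nQI] /=; apply: contrapT => maxI.
  apply/nQI/(step _ sI) => J sJ IJ; apply: contrapT => nQJ; apply: maxI.
  by exists (exist _ J (conj sJ nQJ)).
have [c [_ c_lt]] := dependent_choice next (exist _ I0 (conj sI0 nQI0)).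
have c_sub i j : (i <= j)%N -> sval (c i) `<=` sval (c j).
  elim: j => [|j IH]; first by rewrite leqn0 => /eqP->.
  rewrite leq_eqVlt => /predU1P[->//|/IH cij].
  by apply: subset_trans cij _; case: (c_lt j).
have sc i : submodule (sval (c i)) by case: (svalP (c i)).
have sU : submodule (\bigcup_i sval (c i)).
  apply/submoduleP; split; first by exists 0%N => //; exact: submodule0.
  move=> a u v [i _ cu] [j _ cv]; exists (maxn i j) => //.
  case/submoduleP: (sc (maxn i j)) => _; apply.
    by apply: c_sub cu; exact: leq_maxl.
  by apply: c_sub cv; exact: leq_maxr.
have [s span_s] := noethA _ sU.
have [N sN] : exists N, [set` s] `<=` sval (c N).
  have : [set` s] `<=` \bigcup_i sval (c i) by rewrite -span_s; exact: sub_span.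
  elim: (s) => [|x t IH] tU; first by exists 0%N.
  have [|N tN] := IH; first by move=> y yt; apply: tU; rewrite /= inE yt orbT.
  have [i _ cx] := tU x (mem_head x t).
  exists (maxn i N) => y /=; rewrite inE => /predU1P[->|yt].
    by apply: c_sub cx; exact: leq_maxl.
  by apply: (c_sub N); [exact: leq_maxr | exact: tN].
have [_] := c_lt N; apply.
apply: subset_trans (span_sub (sc N) sN); rewrite span_s.
by move=> y cy; exists N.+1.
Qed.

Lemma idealrP I : idealr_closed [in (I : set A)] <-> submodule I /\ ~ I 1.
Proof.
split=> [[I0 I1 Ilin]|[sI nI1]].
  split; last by move/negP: I1; rewrite inE.
  apply/submoduleP; split; first by rewrite inE in I0.
  by move=> a u v Iu Iv; have := Ilin a u v; rewrite !inE; exact.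
split; first by rewrite inE; exact: (submodule0 sI).
  by apply/negP => /set_mem.
by move=> a u v; rewrite !inE; case/submoduleP: sI => _; exact.
Qed.

Lemma prime_idealP P : prime_ideal P <->
  [/\ submodule P, ~ P 1 & forall u v, P (u * v) -> P u \/ P v].
Proof.
split=> [[/idealrP[sP nP1] Pp]|[sP nP1 Pp]].
  split=> // u v Puv; have := Pp u v; rewrite !inE => /(_ Puv)/orP.
  by rewrite !inE.
split; first by apply/idealrP.
by move=> u v; rewrite !inE => /Pp uv; apply/orP; rewrite !inE.
Qed.

Lemma maximal_idealP m : maximal_ideal m <-> [/\ submodule m, ~ m 1 &
  forall I, submodule I -> ~ I 1 -> m `<=` I -> I `<=` m].
Proof.
split=> [[/idealrP[sm nm1] mmax]|[sm nm1 mmax]].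
  by split=> // I sI nI1 /mmax->//; exact/idealrP.
split=> [|I /idealrP[sI nI1] mI]; first exact/idealrP.
by apply/seteqP; split=> //; exact: mmax.
Qed.

(** Noetherian induction replaces Zorn: a proper ideal that is not maximal lies strictly inside a
    larger proper one. *)
Lemma ex_maximal_ideal I : noetherian A -> submodule I -> ~ I 1 ->
  exists2 m, maximal_ideal m & I `<=` m.
Proof.
move=> noethA; move: I; apply: (noetherian_ind noethA) => I sI IH nI1.
have [maxI|] := pselect (maximal_ideal I); first by exists I.
move=> nmax; have [J [sJ nJ1 IJ nJI]] : exists J, [/\ submodule J, ~ J 1,
  I `<=` J & ~ J `<=` I].
  apply: contrapT => nJ; apply: nmax; apply/maximal_idealP; split=> // J sJ nJ1 IJ.
  by apply: contrapT => nJI; apply: nJ; exists J.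
by have [m maxm Jm] := IH J sJ (conj IJ nJI) nJ1; exists m => //;
  exact: subset_trans Jm.
Qed.

Lemma maximal_ideal_prime m : maximal_ideal m -> prime_ideal m.
Proof.
move=> /maximal_idealP[sm nm1 mmax]; apply/prime_idealP; split=> // u v muv.
have [?|nmu] := pselect (m u); [by left | right].
have su := submodule_line (u : A^o).
have [[z [_ [mz [a _ <-] def1]]]|nJ1] := pselect (sum_set m (line (u : A^o)) 1).
  (* Multiply 1 = z + a u, where z is in m, by v. *)
  have -> : v = v *: (z : A^o) + a *: ((u * v) : A^o).
    by rewrite /GRing.scale/= mulrA [v * z]mulrC -mulrDl -[a * u]/(a *: (u :
      A^o)) -def1 mul1r.
  by apply: submoduleD => //; exact: submoduleZ.
case: nmu; apply: (mmax _ (submodule_sum sm su) nJ1); first exact: sub_suml.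
by apply: sub_sumr => //; exact: line_id.
Qed.

Lemma full_ideal I : submodule I -> I 1 -> I = [set: A^o].
Proof.
move=> sI I1; apply/seteqP; split=> // a _.
by rewrite -[a]mulr1; exact: submoduleZ.
Qed.

Section Local.
Hypothesis localA : local_ring A.

Lemma max_ideal_maximal : maximal_ideal (max_ideal A).
Proof. by apply: xgetPex; case: localA => m [? _]; exists m. Qed.

Lemma submodule_max_ideal : submodule (max_ideal A).
Proof. by case/maximal_idealP: max_ideal_maximal. Qed.

Lemma max_idealN1 : ~ max_ideal A 1.
Proof. by case/maximal_idealP: max_ideal_maximal. Qed.

Lemma proper_sub_max_ideal I : noetherian A -> submodule I -> ~ I 1 ->
  I `<=` max_ideal A.
Proof.
move=> noethA sI nI1; have [m maxm Im] := ex_maximal_ideal noethA sI nI1.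
case: localA => m0 [_ uniq_m]; suff -> : max_ideal A = m by [].
by rewrite -(uniq_m _ max_ideal_maximal) (uniq_m _ maxm).
Qed.

End Local.
End Noetherian.

(** * Growth of the colength of [a + J e] with [e] *)

Section Growth.
Context {K : realType} {A : comNzRingType}.
Implicit Types (a b I P m : set A^o).
Local Notation len := (@rlen K A A^o).

(** In effect the spectrum of A / a, whose chains measure dim (A / a). *)
Definition primes_above a : set (set A^o) := [set P | prime_ideal P /\ a `<=` P].

Definition colon a (x : A^o) : set A^o := [set c : A | a (c *: x)].

Lemma submodule_colon a x : submodule a -> submodule (colon a x).
Proof.
move=> sa; apply/submoduleP; split=> [|c u v au av]; rewrite /colon /=.
  by rewrite scale0r; exact: submodule0.
by rewrite scalerDl -[(c *: u) *: x]scalerA; case/submoduleP: sa => _; exact.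
Qed.

Lemma sub_colon a x : submodule a -> a `<=` colon a x.
Proof.
move=> sa c ac; have -> : colon a x c = a (x *: c) by rewrite /colon /=
  /GRing.scale /= mulrC.
exact: submoduleZ.
Qed.

Lemma rlen_full a : submodule a -> a 1 -> (len a [set: A^o] <= 0)%E.
Proof.
move=> sa a1; apply/chain_sup_ubP => n E [c [Pc c_lt _]].
case: n => // n in Pc c_lt *.
have [//|s0 a0 _] := Pc 0%N; have [_] := c_lt 0%N isT; case.
by rewrite (full_ideal s0 (a0 _ a1)).
Qed.

(** In a chain of three ideals above m, the middle one is either the whole ring or proper and so
    inside m; in both cases some step is not strict. *)
Lemma rlen_max_ideal : local_ring A -> noetherian A ->
  (len (max_ideal A) [set: A^o] <= 1)%E.
Proof.
move=> locA noethA; apply/chain_sup_ubP => n E [c [Pc c_lt _]].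
case: n => [|[|n]] in Pc c_lt *; rewrite ?lee_fin//.
have [//|s0 m0 _] := Pc 0%N; have [//|s1 m1 _] := Pc 1%N.
have [_ n10] := c_lt 0%N isT; have [_ n21] := c_lt 1%N isT.
have [c1|nc1] := pselect (c 1%N 1); first by case: n21; rewrite (full_ideal s1 c1).
by case: n10; apply: subset_trans m0; exact: proper_sub_max_ideal.
Qed.

(** Filter by the ideals b + (x^i) for i up to n. Each of the n successive quotients is generated by
    the class of x^i and killed by b + (x), so its length is at most that of A / (b + (x)). *)
Lemma rlen_power b x (c n : nat) : submodule b ->
  (len (sum_set b (line x)) [set: A^o] <= c%:R%:E)%E ->
  (len (sum_set b (line (x ^+ n : A^o))) [set: A^o] <= (n * c)%:R%:E)%E.
Proof.
move=> sb le_c; have sbl (y : A^o) : submodule (sum_set b (line y)).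
  by apply: submodule_sum => //; exact: submodule_line.
elim: n => [|n IH].
  apply: rlen_full => //; apply: sub_sumr => //; exact: line_id.
have sub : sum_set b (line (x ^+ n.+1 : A^o)) `<=` sum_set b (line (x ^+ n : A^o)).
  apply: sum_setS => //; apply: line_sub; first exact: submodule_line.
  by exists x => //; rewrite exprS.
rewrite (rlenD (sbl _) (sbl (x ^+ n)) submoduleT sub)// mulSn natrD EFinD.
apply: leeD => //; apply: le_trans le_c.
have colon_x c' : sum_set b (line x) c' ->
  sum_set b (line (x ^+ n.+1 : A^o)) (c' *: (x ^+ n : A^o)).
  move=> [y [_ [b_y [z _ <-] ->]]]; rewrite scalerDl; apply: (submoduleD (sbl _)).
    apply: sub_suml; first exact: submodule_line.
    by have -> : y *: (x ^+ n : A^o) = x ^+ n *: y;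
      [exact: mulrC | exact: submoduleZ].
  by apply: sub_sumr => //; exists z => //; rewrite /GRing.scale/= exprS mulrA.
apply: le_trans (rlen_line (sbl _) colon_x).
apply: rlen_sub => //; apply: sum_setS => //; apply: sub_suml.
exact: submodule_line.
Qed.

Section Bound.
(** Abstract counterparts of J_e and p^e; [powJ] is the link between them. *)
Variables (J : nat -> set A^o) (q : nat -> nat).
Hypotheses (noethA : noetherian A) (locA : local_ring A).
Hypotheses (sJ : forall e, submodule (J e)) (q_gt0 : forall e, (0 < q e)%N).
Hypothesis powJ : forall e (x : A), max_ideal A x -> J e (x ^+ q e).

(* If x y \in a, then A / (a : x) and A / (a + A x) filter A / a; both ideals are
   larger than a unless a is prime. *)
Lemma growth_step k a :
  (prime_ideal a -> a `<=` max_ideal A ->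
    exists C, forall e, (len (sum_set a (J e)) [set: A^o]
      <= (C * q e ^ k)%:R%:E)%E) ->
  submodule a ->
  (forall b, submodule b -> a `<` b -> (forall P,
    ~ chain_to (primes_above b) k.+1 P) ->
    exists C, forall e, (len (sum_set b (J e)) [set: A^o]
      <= (C * q e ^ k)%:R%:E)%E) ->
  (forall P, ~ chain_to (primes_above a) k.+1 P) ->
  exists C, forall e, (len (sum_set a (J e)) [set: A^o] <= (C * q e ^ k)%:R%:E)%E.
Proof.
move=> prime_case sa IHa no_chain;
  have saJ e : submodule (sum_set a (J e)) by exact: submodule_sum.
have [a1|na1] := pselect (a 1).
  exists 0%N => e; rewrite mul0n; apply: rlen_full;
    [exact: saJ | exact: (sub_suml (sJ e) a1)].
have [|not_prime] := pselect (prime_ideal a).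
  by move=> /prime_case; apply; exact: proper_sub_max_ideal.
have [x [y [axy nax nay]]] : exists x y, [/\ a (x * y), ~ a x & ~ a y].
  apply: contrapT => nxy; apply/not_prime/prime_idealP; split=> // x y axy.
  apply: contrapT => /not_orP[nax nay]; apply: nxy.
  by exists x, y.
have sax : submodule (sum_set a (line (x : A^o))).
  by apply: submodule_sum => //; exact: submodule_line.
have a_ax : a `<=` sum_set a (line (x : A^o)) by apply: sub_suml;
  exact: submodule_line.
have nochain b : a `<=` b -> forall P, ~ chain_to (primes_above b) k.+1 P.
  move=> ab P cP; apply: (no_chain P); apply: chain_to_sub cP => Q [Qp bQ].
  by split=> //; exact: subset_trans bQ.
have sc := submodule_colon x sa; have a_c := sub_colon x sa.
have [||C1 leC1] := IHa _ sc; [|exact: nochain|].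
  by split=> // /(_ y) ca; apply/nay/ca; rewrite /colon/= /GRing.scale/= mulrC.
have [||C2 leC2] := IHa _ sax; [|exact: nochain|].
  by split=> // /(_ x) axa; apply/nax/axa/sub_sumr => //; exact: line_id.
exists (C1 + C2)%N => e; have saJx : submodule
    (sum_set (sum_set a (J e)) (line (x : A^o))).
  by apply: submodule_sum => //; exact: submodule_line.
have aJ_x : sum_set a (J e) `<=` sum_set (sum_set a (J e)) (line (x : A^o)).
  by apply: sub_suml; exact: submodule_line.
(* Split A / (a + J e) at a + J e + A x. The lower piece is cyclic and killed by (a : x) + J e,
   which gives [C1]; the upper one is bounded by [C2]. *)
rewrite (rlenD _ saJx submoduleT)// mulnDl natrD EFinD; apply: leeD.
  apply: le_trans (leC1 e); apply: rlen_line => // _ [c [j [ac Jj ->]]].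
  rewrite scalerDl; apply: (submoduleD (saJ e)); first exact: sub_suml.
  apply: sub_sumr => //; have -> : j *: (x : A^o) = x *: j by exact: mulrC.
  exact: (submoduleZ _ (sJ e)).
apply: le_trans (leC2 e); apply: rlen_sub => //; apply: sum_sub => //.
  apply: sum_sub => //; first by apply: subset_trans aJ_x; exact: sub_suml.
  exact: sub_sumr.
by apply: subset_trans aJ_x; exact: sub_sumr.
Qed.

(* The hypothesis on chains says that dim A / a <= k.  For a prime, any x in the
   maximal ideal outside a lowers the dimension, while x ^+ q e \in J e costs only
   a factor q e. *)
Lemma growth_bound k a : submodule a ->
  (forall P, ~ chain_to (primes_above a) k.+1 P) ->
  exists C, forall e, (len (sum_set a (J e)) [set: A^o] <= (C * q e ^ k)%:R%:E)%E.
Proof.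
elim: k a => [|k IHk]; apply: (noetherian_ind noethA) => a sa IHa no_chain.
  apply: (growth_step _ sa IHa no_chain) => a_prime am.
  exists 1%N => e; rewrite expn0 muln1;
    apply: le_trans (rlen_max_ideal locA noethA).
  apply: rlen_sub => //; apply: subset_trans (sub_suml (sJ e)).
  (* In dimension 0 the prime [a] must be the maximal ideal, since otherwise a < m is a chain of
     primes of length 1. *)
  apply: contrapT => nma; apply: (no_chain (max_ideal A)).
  have prime_m := maximal_ideal_prime (max_ideal_maximal locA).
  have ca : chain_to (primes_above a) 0 a by apply: chain_to0; split.
  by apply: (chain_toS ca); split.
apply: (growth_step _ sa IHa no_chain) => a_prime am.
have [ma|nma] := pselect (max_ideal A `<=` a).
  (* Here [a] contains the maximal ideal, so the length is at most 1, and the power of [q e] is at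
     least 1. *)
  exists 1%N => e; rewrite mul1n; apply: (@le_trans _ _ 1%E).
    apply: le_trans (rlen_max_ideal locA noethA); apply: rlen_sub => //.
    exact: subset_trans (sub_suml (sJ e)).
  by rewrite lee_fin -[1]/(1%:R) ler_nat expn_gt0 q_gt0.
have [x mx nax] : exists2 x, max_ideal A x & ~ a x.
  by apply: contrapT => nx; apply: nma => x mx; apply: contrapT => nax;
    apply: nx; exists x.
have sax : submodule (sum_set a (line x)).
  by apply: submodule_sum => //; exact: submodule_line.
have ax : sum_set a (line x) x by apply: sub_sumr => //; exact: line_id.
have a_ax : a `<=` sum_set a (line x) by apply: sub_suml; exact: submodule_line.
(* Since [a] is prime and misses x, putting it below a chain of primes above a + A x gives a chain
   above [a] that is longer by one. *)
have [|C leC] := IHk _ sax.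
  move=> P cP; apply: (no_chain P); apply: (chain_to_cons (E := a) _ _ cP);
    first by split.
  move=> G [Gp axG]; have aG := subset_trans a_ax axG.
  by split; [split | split=> // Ga; apply/nax/Ga/axG].
exists C => e; have saJ : submodule (sum_set a (J e)) by exact: submodule_sum.
rewrite expnS mulnCA.
(* With b = a + J e, adjoining x^(q e) does not enlarge b, because this power already lies in
   [J e]. *)
apply: le_trans (rlen_power (x := x) (q e) saJ _).
  apply: rlen_sub => //; apply: sum_sub => //; apply: line_sub => //.
  by apply: sub_sumr => //; exact: powJ.
apply: le_trans (leC e); apply: rlen_sub => //.
apply: sum_sub; last by apply: subset_trans (sub_suml _);
  [exact: sub_sumr | exact: submodule_line].
  by apply: submodule_sum => //; exact: submodule_line.
apply: sum_setS => //; exact: sub_suml.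
Qed.


End Bound.
End Growth.

(** * Products and powers of ideals, and the growth of [hs_length] *)

Section IdealOperations.
Context {A : comNzRingType}.
Implicit Types (I J : set A^o).

Lemma submodule_ideal_mul (V : lmodType A) I (S : set V) : submodule (ideal_mul
  I S).
Proof. exact: submodule_span. Qed.

Lemma mem_ideal_mul (V : lmodType A) I (S : set V) a x : I a -> S x ->
  ideal_mul I S (a *: x).
Proof. by move=> Ia Sx; apply: sub_span; exists a, x. Qed.

Lemma ideal_mul_sub (V : lmodType A) I (S T : set V) : submodule T ->
  (forall a x, I a -> S x -> T (a *: x)) -> ideal_mul I S `<=` T.
Proof. by move=> sT IST; apply: span_sub => // _ [a [x [Ia Sx ->]]];
  exact: IST. Qed.

Lemma ideal_mulS (V : lmodType A) I J (S T : set V) : I `<=` J -> S `<=` T ->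
  ideal_mul I S `<=` ideal_mul J T.
Proof.
move=> IJ ST; apply: ideal_mul_sub; first exact: submodule_ideal_mul.
by move=> a x /IJ Ja /ST Tx; exact: mem_ideal_mul.
Qed.

Lemma ideal_mulT I : submodule I -> ideal_mul I [set: A^o] = I.
Proof.
move=> sI; apply/seteqP; split.
  apply: ideal_mul_sub => // a x Ia _.
  by have -> : a *: (x : A^o) = x *: (a : A^o); [exact: mulrC | exact: submoduleZ].
by move=> a Ia; rewrite -[a]mulr1; exact: (mem_ideal_mul (V := A^o)).
Qed.

Lemma submodule_ideal_exp I n : submodule (ideal_exp I n).
Proof. by case: n => [|n]; [exact: submoduleT | exact: submodule_ideal_mul]. Qed.

Lemma ideal_expS I J n : I `<=` J -> ideal_exp I n `<=` ideal_exp J n.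
Proof. by move=> IJ; elim: n => [|n IH] //; exact: ideal_mulS. Qed.

Lemma frobenius_powerS I J q : I `<=` J ->
  frobenius_power I q `<=` frobenius_power J q.
Proof.
move=> IJ; apply: span_sub; first exact: submodule_span.
by move=> _ [x /IJ Jx ->]; apply: sub_span; exists x.
Qed.

Context {K : realType}.

Lemma submodule_hs_ideal p (s : K) I J e : submodule (hs_ideal p s I J e).
Proof. by apply: submodule_sum;
  [exact: submodule_ideal_exp | exact: submodule_span]. Qed.

Lemma hs_idealS p (s : K) I J e : I `<=` J ->
  hs_ideal p s I I e `<=` hs_ideal p s J J e.
Proof.
by move=> IJ; apply: sum_setS; [exact: ideal_expS | exact: frobenius_powerS].
Qed.

Lemma hs_ideal_pow p (s : K) I J e x : J x -> hs_ideal p s I J e (x ^+ (p ^ e)).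
Proof.
move=> Jx; apply: sub_sumr; first exact: submodule_ideal_exp.
by apply: sub_span; exists x.
Qed.

Lemma hs_lengthE p (s : K) I J (V : lmodType A) e :
  hs_length p s I J V e = rlen (ideal_mul (hs_ideal p s I J e) [set: V]) [set: V].
Proof. by apply: module_length_quotmod; exact: submodule_ideal_mul. Qed.

Lemma hs_length_ge0 p (s : K) I J (V : lmodType A) e : (0 <= hs_length p s I J
  V e)%E.
Proof. by rewrite hs_lengthE; apply: rlen_ge0 => //;
  exact: submodule_ideal_mul. Qed.

Lemma hs_length_ring p (s : K) I J e :
  hs_length p s I J A^o e = rlen (hs_ideal p s I J e) [set: A^o].
Proof. by rewrite hs_lengthE ideal_mulT//; exact: submodule_hs_ideal. Qed.

(** Adjoin the generators in [t] to [S] one at a time: each step is a cyclic quotient killed by [b],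
    of length at most that of A / b. *)
Lemma rlen_span (V : lmodType A) (S : set V) (b : set A^o) (c : nat) (t : seq V) :
  submodule S -> (forall a x,
    b a -> S (a *: x)) -> submod_span [set` t] = [set: V] ->
  (rlen b [set: A^o] <= c%:R%:E :> \bar K)%E ->
  (rlen S [set: V] <= (size t * c)%:R%:E :> \bar K)%E.
Proof.
move=> sS bS <- le_c; pose F := foldr (fun x T => sum_set T (line x)) S.
have sF r : submodule (F r).
  by elim: r => [|x r IH] //=; apply: submodule_sum => //; exact: submodule_line.
have FS x r : F r `<=` F (x :: r) by apply: sub_suml; exact: submodule_line.
have SF r : S `<=` F r by elim: r => [|x r IH] //; exact: subset_trans (FS x r).
have tF r : [set` r] `<=` F r.
  elim: r => [|x r IH] //= y; rewrite /= inE => /predU1P[->|yr].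
    by apply: sub_sumr => //; exact: line_id.
  by apply: (FS x); exact: IH.
apply: (@le_trans _ _ (rlen S (F t))).
  by apply: rlen_sub => //; apply: span_sub => //; exact: tF.
elim: t => [|x t IH].
  apply/chain_sup_ubP => n E [d [Pd d_lt _]]; case: n => // n in Pd d_lt *.
  have [_] := d_lt 0%N isT; case; have [//|_ Sd0 _] := Pd 0%N.
  by have [//|_ _ dS] := Pd 1%N; exact: subset_trans Sd0.
rewrite (rlenD sS (sF t) (sF _) (SF t) (FS x t)) /= mulSn addnC natrD EFinD.
apply: leeD => //; apply: le_trans le_c; apply: rlen_line => // a ba.
exact/SF/bS.
Qed.

(** [growth_bound] at the annihilator of V, transferred to V through its generators: Ann V + J_e
    carries V into J_e V. *)
Lemma hs_length_growth p (s : K) (V : lmodType A) d : (0 < p)%N ->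
  noetherian A -> local_ring A -> fin_gen V -> (module_dim K V < d.+1%:R%:E)%E ->
  exists C : nat, forall e, (hs_length p s (max_ideal A) (max_ideal A) V e
    <= (C * (p ^ e) ^ d)%:R%:E)%E.
Proof.
move=> p_gt0 noethA locA [t span_t] dimV.
have s_ann : submodule (annihilator V).
  apply/submoduleP; split=> [x|a u v au av x]; first exact: scale0r.
  by rewrite scalerDl -scalerA au av scaler0 addr0.
pose J := hs_ideal p s (max_ideal A) (max_ideal A).
have sJ e : submodule (J e) by exact: submodule_hs_ideal.
have q_gt0 e : (0 < p ^ e)%N by rewrite expn_gt0 p_gt0.
have powJ e (x : A) : max_ideal A x -> J e (x ^+ (p ^ e)) by exact: hs_ideal_pow.
have [|C leC] := growth_bound (K := K) noethA locA sJ q_gt0 powJ (k := d) s_ann.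
  move=> P /chain_to_le_sup -/(_ K); rewrite leNgt; move/negP; exact.
exists (size t * C)%N => e; rewrite hs_lengthE -mulnA.
apply: rlen_span span_t (leC e); first exact: submodule_ideal_mul.
move=> _ x [a [b [aann hb ->]]].
by rewrite scalerDl aann add0r; exact: mem_ideal_mul.
Qed.

End IdealOperations.

(** * Ideals of the idealization: extensions, lengths, primes *)

Section IdealizationIdeals.
Context {R : comNzRingType} {M : lmodType R}.
Local Notation A := (idealization R M).
Implicit Types (I J E F : set R^o) (S : set M) (T : set A^o).

Lemma idealization_lin (c u v : A^o) : c *: u + v =
  (c.1 * u.1 + v.1, c.1 *: u.2 + u.1 *: c.2 + v.2).
Proof. by []. Qed.

Lemma submodule_idealization_ideal I S : submodule I -> submodule S ->
  (forall a x, I a -> S (a *: x)) -> submodule (@idealization_ideal R M I S).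
Proof.
move=> sI sS IS; apply/submoduleP; split; first by split;
  [exact: (submodule0 sI) | exact: (submodule0 sS)].
move=> c u v [Iu Su] [Iv Sv]; rewrite idealization_lin; split=> /=.
  by case/submoduleP: sI => _ /(_ c.1 u.1 v.1); exact.
apply: submoduleD => //; apply: submoduleD => //; first exact: submoduleZ.
exact: IS.
Qed.

(** The preimage under a -> (a, 0) rather than the projection to R; the two agree for the ideals
    containing 0 |x M, and such an ideal is recovered from it. *)
Definition ring_part T : set R^o := [set a : R^o | T (a, 0)].

Definition module_part T : set M := [set x | T (0, x)].

Lemma submodule_ring_part T : submodule T -> submodule (ring_part T).
Proof.
move=> sT; apply/submoduleP; split; first exact: (submodule0 sT).
move=> a u v Tu Tv; rewrite /ring_part /=.
have -> : (a *: u + v, 0) = ((a, 0) : A^o) *: ((u, 0) : A^o) + (v, 0).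
  by rewrite idealization_lin /= !scaler0 !addr0.
by case/submoduleP: sT => _; exact.
Qed.

Lemma submodule_module_part T : submodule T -> submodule (module_part T).
Proof.
move=> sT; apply/submoduleP; split; first exact: (submodule0 sT).
move=> a u v Tu Tv; rewrite /module_part /=.
have -> : (0, a *: u + v) = ((a, 0) : A^o) *: ((0, u) : A^o) + (0, v).
  by rewrite idealization_lin /= mulr0 scaler0 !addr0.
by case/submoduleP: sT => _; exact.
Qed.

(* The ideal I |x I M, that is I (R |x M). *)
Definition extension I : set A^o :=
  @idealization_ideal R M I (ideal_mul I [set: M]).

Lemma submodule_extension I : submodule I -> submodule (extension I).
Proof.
move=> sI; apply: submodule_idealization_ideal => //;
  first exact: submodule_ideal_mul.
by move=> a x Ia; exact: mem_ideal_mul.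
Qed.

(** The pairs (c, 0) with c in I generate the extension, because (0, c z) = (0, z) (c, 0). *)
Lemma extension_sub I T : submodule T -> I `<=` ring_part T -> extension I `<=` T.
Proof.
move=> sT IT [a x] [/= Ia IMx].
have -> : (a, x) = ((a, 0) : A^o) + (0, x) by congr pair; rewrite /= ?addr0 ?add0r.
apply: submoduleD => //; first exact: IT.
have sM := submodule_module_part sT.
suff : ideal_mul I [set: M] `<=` module_part T by exact.
apply: ideal_mul_sub => // c z /IT Tc _; rewrite /module_part /=.
have -> : (0, c *: z) = ((0, z) : A^o) *: ((c, 0) : A^o).
  by congr pair; rewrite /= ?mul0r// scale0r add0r.
exact: submoduleZ.
Qed.

Lemma extension_mul I J : submodule I -> submodule J ->
  ideal_mul (extension I) (extension J) = extension (ideal_mul I J).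
Proof.
move=> sI sJ; have sIJ : submodule (ideal_mul I J) := submodule_ideal_mul _ _.
have sIJM : submodule (ideal_mul (ideal_mul I J) [set: M]) :=
  submodule_ideal_mul _ _.
apply/seteqP; split.
  apply: ideal_mul_sub; first exact: submodule_extension.
  move=> [a x] [b y] [/= Ia IMx] [/= Jb JMy]; split=> /=;
    first exact: mem_ideal_mul.
  (* If c F lies in I J, then c (F M) lies in (I J) M. In (a, x) (b, y) = (a b, a y + b x) this
     serves a y with F = J and b x with F = I. *)
  have nested (c : R^o) (F : set R^o) : (forall b',
    F b' -> ideal_mul I J (c * b')) ->
      ideal_mul F [set: M] `<=` [set z | ideal_mul (ideal_mul I J) [set: M]
        (c *: z)].
    move=> cF; apply: ideal_mul_sub.
      apply/submoduleP; split=> [|c' u v cu cv] /=; first by rewrite scaler0;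
        exact: submodule0.
      rewrite scalerDr scalerA mulrC -scalerA.
      by case/submoduleP: sIJM => _; exact.
    by move=> b' z /cF cb' _ /=; rewrite scalerA; exact: mem_ideal_mul.
  apply: (submoduleD sIJM).
    by apply: nested JMy => b'; exact: mem_ideal_mul.
  by apply: nested IMx => a' Ia'; rewrite mulrC; exact: mem_ideal_mul.
apply: extension_sub; first exact: submodule_ideal_mul.
apply: ideal_mul_sub; first exact/submodule_ring_part/submodule_ideal_mul.
move=> a b Ia Jb; rewrite /ring_part /=.
have -> : (a *: b, 0) = ((a, 0) : A^o) *: ((b, 0) : A^o).
  by congr pair; rewrite /= !scaler0 addr0.
by apply: mem_ideal_mul; split=> //=; apply: submodule0; exact: submodule_ideal_mul.
Qed.

Lemma extensionT : extension [set: R^o] = [set: A^o].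
Proof.
apply/seteqP; split=> // -[a x] _; split=> //=.
by rewrite -[x]scale1r; exact: mem_ideal_mul.
Qed.

Lemma extension_exp I n : submodule I ->
  ideal_exp (extension I) n = extension (ideal_exp I n).
Proof.
move=> sI; elim: n => [|n IH]; first exact/esym/extensionT.
by apply: etrans (extension_mul sI (submodule_ideal_exp I n)); rewrite -IH.
Qed.

Lemma extensionD I J : submodule I -> submodule J ->
  sum_set (extension I) (extension J) = extension (sum_set I J).
Proof.
move=> sI sJ; have sIJ := submodule_sum sI sJ.
have [sAI sAJ] := (submodule_extension sI, submodule_extension sJ).
apply/seteqP; split.
  apply: sum_sub; first exact: submodule_extension.
    move=> u [Iu IMu]; split; first exact: sub_suml.
    by apply: ideal_mulS IMu => //; exact: sub_suml.
  move=> u [Ju JMu]; split; first exact: sub_sumr.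
  by apply: ideal_mulS JMu => //; exact: sub_sumr.
apply: extension_sub; first exact: submodule_sum.
have sub0 L a : submodule L -> L a -> extension L (a, 0).
  by move=> sL La; split=> //=; apply: submodule0; exact: submodule_ideal_mul.
move=> _ [a [b [Ia Jb ->]]]; exists (a, 0), (b, 0); split;
  [exact: sub0 | exact: sub0 |].
by congr pair; rewrite /= ?addr0.
Qed.

(** The power rule, valid because products of two elements of 0 |x M vanish. At n = 0 the truncated
    exponent [n.-1] is harmless, being multiplied by 0. *)
Lemma idealizationX (u : A) n :
  u ^+ n = (u.1 ^+ n, (u.1 ^+ n.-1 *+ n) *: u.2).
Proof.
elim: n => [|n IH]; first by rewrite !expr0 mulr0n scale0r.
rewrite exprS IH; congr pair; rewrite /= ?exprS// scalerA -scalerDl mulrnAr.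
by case: n {IH} => [|n]; rewrite ?mulr0n ?add0r// -exprS /= addrC -mulrS.
Qed.

(** As q vanishes in R, the power rule leaves no module component in a q-th power. *)
Lemma extension_frobenius I q : submodule I -> q%:R = 0 :> R ->
  frobenius_power (extension I) q = extension (frobenius_power I q).
Proof.
move=> sI q0; have powE (u : A) : u ^+ q = (u.1 ^+ q, 0).
  by rewrite idealizationX -mulr_natr q0 mulr0 scale0r.
have sF : submodule (frobenius_power I q) := submodule_span _.
apply/seteqP; split.
  apply: span_sub; first exact: submodule_extension.
  move=> _ [u [Iu _] ->]; rewrite powE; split=> /=; first by apply: sub_span;
    exists u.1.
  by apply: submodule0; exact: submodule_ideal_mul.
apply: extension_sub; first exact: submodule_span.
apply: span_sub; first exact/submodule_ring_part/submodule_span.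
move=> _ [a Ia ->]; apply: sub_span; exists (a, 0); last by rewrite powE.
by split=> //=; apply: submodule0; exact: submodule_ideal_mul.
Qed.

(** Stated for the exponents [e.+1], where p^(e + 1) vanishes in R; the term at 0 does not affect a
    limit. *)
Lemma extension_hs_ideal (K : realType) p (s : K) I e : submodule I ->
  p \in [pchar R] -> hs_ideal p s (extension I) (extension I) e.+1
    = extension (hs_ideal p s I I e.+1).
Proof.
move=> sI charR.
have q0 : (p ^ e.+1)%:R = 0 :> R by rewrite natrX (pcharf0 charR) expr0n.
apply: etrans (extensionD (submodule_ideal_exp I _) (submodule_span _)).
by rewrite -extension_exp// -extension_frobenius.
Qed.

(** Split at I |x M. Ideals above it correspond to ideals of R above I through [ring_part]; ideals
    between I |x S and I |x M correspond to submodules above S through [module_part]. *)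
Lemma rlen_idealization (K : realType) I S : submodule I -> submodule S ->
  (forall a x, I a -> S (a *: x)) ->
  rlen (idealization_ideal I S) [set: A^o] = (rlen I [set: R^o]
    + rlen S [set: M] :> \bar K)%E.
Proof.
move=> sI sS IS; have sIT : submodule (@idealization_ideal R M I [set: M]).
  exact: submodule_idealization_ideal submoduleT _.
have sIS := submodule_idealization_ideal sI sS IS.
have sub : @idealization_ideal R M I S `<=` @idealization_ideal R M I [set: M]
  by move=> u [].
rewrite (rlenD sIS sIT submoduleT sub)// addeC; congr (_ + _)%E; apply/eqP;
  rewrite eq_le; apply/andP; split.
- apply: (@chain_sup_le _ _ _ _ _ ring_part) =>
    [T [sT IT _]|T T' [sT IT _] [sT' IT' _]].
    split=> //; first exact: submodule_ring_part.
    by move=> a Ia; apply: IT.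
  split=> [TT' [a x] Tax|TT' a /TT'//].
  have x_in T0 : @idealization_ideal R M I [set: M] `<=` T0 -> T0 (0, x).
    by apply; split=> //; exact: (submodule0 sI).
  have -> : (a, x) = ((a, 0) : A^o) + (0, x) by congr pair;
    rewrite /= ?addr0 ?add0r.
  apply: submoduleD => //; last exact: x_in.
  apply: TT'; rewrite /ring_part /=.
  have -> : (a, 0) = ((a, x) : A^o) - (0, x) by congr pair;
    rewrite /= ?subr0 ?subrr.
  by apply: submoduleB => //; exact: x_in.
- apply: (@chain_sup_le _ _ _ _ _ (fun I' =>
    @idealization_ideal R M I' [set: M])) => [I' [sI' II' _]|I' I2 _ _].
    split=> //; first exact: submodule_idealization_ideal submoduleT _.
    by move=> u [/II']; split.
  by split=> [sub' a I'a|sub' u [/sub']];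
    [have [] := sub' (a, 0) (conj I'a Logic.I) | split].
- apply: (@chain_sup_le _ _ _ _ _ module_part) =>
    [T [sT IT _]|T T' [sT IT TI] [sT' IT' _]].
    split=> //; first exact: submodule_module_part.
    by move=> x Sx; apply: IT; split=> //; exact: (submodule0 sI).
  split=> [TT' [a x] Tax|TT' x /TT'//].
  have a_in T0 : @idealization_ideal R M I S `<=` T0 -> T0 (a, 0).
    by apply; split; [have [] := TI _ Tax | exact: submodule0].
  have -> : (a, x) = ((a, 0) : A^o) + (0, x) by congr pair;
    rewrite /= ?addr0 ?add0r.
  apply: submoduleD => //; first exact: a_in.
  apply: TT'; rewrite /module_part /=.
  have -> : (0, x) = ((a, x) : A^o) - (a, 0) by congr pair;
    rewrite /= ?subr0 ?subrr.
  by apply: submoduleB => //; exact: a_in.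
apply: (@chain_sup_le _ _ _ _ _ (fun S' => @idealization_ideal R M I S')) =>
  [S' [sS' SS' _]|S' S2 _ _].
  split=> //; last by move=> u [].
    by apply: submodule_idealization_ideal => // a x Ia; exact/SS'/IS.
  by move=> u [Iu /SS']; split.
have I0 := submodule0 sI.
by split=> [sub' x S'x|sub' u [Iu /sub']];
  [have [] := sub' (0, x) (conj I0 S'x) | split].
Qed.

(** The element (0, x) has square zero. *)
Lemma prime_nilpotent_part T x : prime_ideal T -> T (0, x).
Proof.
move=> /prime_idealP[sT _ Tp].
have [||] := Tp (0, x) (0, x) => //.
have -> : ((0, x) : A) * (0, x) = 0 by congr pair;
  rewrite /= ?mulr0// scale0r addr0.
exact: (submodule0 sT).
Qed.

(** Every prime contains 0 |x M, so the primes are the P |x M with P prime in R, and both directions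
    preserve and reflect inclusion. *)
Lemma krull_dim_idealization (K : realType) : krull_dim A K = krull_dim R K.
Proof.
apply/eqP; rewrite eq_le; apply/andP; split.
  apply: (@chain_sup_le _ _ _ _ _ ring_part) =>
    [T /prime_idealP[sT T1 Tp]|T T' pT pT'].
    apply/prime_idealP; split=> //; first exact: submodule_ring_part.
    move=> a b; rewrite /ring_part /=.
    have -> : (a * b, 0) = ((a, 0) : A) * (b, 0) by congr pair;
      rewrite /= !scaler0 addr0.
    exact: Tp.
  split=> [TT' [a x] Tax|TT' a /TT'//].
  have /prime_idealP[sT _ _] := pT; have /prime_idealP[sT' _ _] := pT'.
  have -> : (a, x) = ((a, 0) : A^o) + (0, x) by congr pair;
    rewrite /= ?addr0 ?add0r.
  apply: submoduleD => //; last exact: prime_nilpotent_part.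
  apply: TT'; rewrite /ring_part /=.
  have -> : (a, 0) = ((a, x) : A^o) - (0, x) by congr pair;
    rewrite /= ?subr0 ?subrr.
  by apply: submoduleB => //; exact: prime_nilpotent_part.
apply: (@chain_sup_le _ _ _ _ _ (fun I' => @idealization_ideal R M I' [set: M])).
  move=> P /prime_idealP[sP nP1 Pp]; apply/prime_idealP; split.
  - exact: submodule_idealization_ideal submoduleT _.
  - by case.
  - by move=> u v [/Pp[]]; [left | right].
by move=> P P' _ _; split=> [sub' a Pa|sub' u [/sub']];
  [have [] := sub' (a, 0) (conj Pa Logic.I) | split].
Qed.

(** The ideal n = m |x M contains every proper ideal, so it is maximal; hence [max_ideal] picks a
    genuine maximal ideal, and this one lies in n and equals it. *)
Lemma extension_sub_max_ideal : noetherian R -> local_ring R ->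
  extension (max_ideal R) `<=` max_ideal A.
Proof.
move=> noethR locR; have sm := submodule_max_ideal locR;
  have nm1 := max_idealN1 locR.
pose n : set A^o := @idealization_ideal R M (max_ideal R) [set: M].
have sn : submodule n by exact: submodule_idealization_ideal submoduleT _.
have nn1 : ~ n 1 by case.
have n_max T : submodule T -> ~ T 1 -> T `<=` n.
  move=> sT nT1 [a x] Tax; split=> //=.
  (* The projection of T to R. Were 1 in it, T would contain some (1, y), a unit with inverse (1,
     -y). *)
  pose T1 : set R^o := [set b : R^o | exists y, T (b, y)].
  apply: (@proper_sub_max_ideal _ locR T1) => //; last by exists x.
    apply/submoduleP; split; first by exists 0; exact: (submodule0 sT).
    move=> c u v [y Tu] [z Tv]; exists (c *: y + z).
    have -> : (c *: u + v, c *: y + z) = ((c, 0) : A^o) *: ((u, y) : A^o) + (v, z).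
      by rewrite idealization_lin /= scaler0 addr0.
    by case/submoduleP: sT => _; exact.
  move=> [y T1y]; apply: nT1.
  have -> : 1 = ((1, - y) : A^o) *: ((1, y) : A^o).
    by congr pair; rewrite /= ?mulr1// !scale1r subrr.
  exact: submoduleZ.
have maxn : maximal_ideal n by apply/maximal_idealP; split=> // T sT nT1 _;
  exact: n_max.
have : maximal_ideal (max_ideal A) by apply: xgetPex; exists n.
move=> /maximal_idealP[smA nmA1 mA_max] u [mu _].
by apply: (mA_max n sn nn1); [exact: n_max | split].
Qed.

End IdealizationIdeals.

(** * Nonnegativity of the normalizer *)

Section Normalizer.
Context {K : realType}.
Implicit Types (s : K) (d n : nat).

(** The number [n] of terms is independent of [s], so that the recurrence can lower both
    separately. *)
Definition alt_sum n d s : K :=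
  \sum_(0 <= i < n) (-1) ^+ i * 'C(d, i)%:R * (s - i%:R) ^+ d.

(* The recurrence of the Irwin-Hall distribution function, d! times which is
   [alt_sum]. *)
Lemma alt_sumS n d s : alt_sum n.+1 d.+1 s =
  s * alt_sum n.+1 d s + (d.+1%:R - s) * alt_sum n d (s - 1).
Proof.
rewrite /alt_sum.
have -> : \sum_(0 <= i < n.+1) (-1) ^+ i * 'C(d.+1, i)%:R * (s - i%:R) ^+ d.+1 =
  \sum_(0 <= i < n.+1) (s * ((-1) ^+ i * 'C(d, i)%:R * (s - i%:R) ^+ d)) +
  \sum_(0 <= i < n.+1) ((-1) ^+ i * (s * 'C(d.+1, i)%:R - s * 'C(d,
    i)%:R - i%:R * 'C(d.+1, i)%:R) * (s - i%:R) ^+ d).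
  by rewrite -big_split /=; apply: eq_bigr => i _; rewrite exprS; ring.
rewrite -mulr_sumr; congr (_ + _).
(* The remainder has no term at i = 0. After a shift of the index, Pascal's rule and (i + 1) C(d +
   1, i + 1) = (d + 1) C(d, i) turn it into the sum at s - 1. *)
rewrite big_nat_recl//= !bin0 mul0r !subrr !mulr0 mul0r add0r mulr_sumr.
apply: eq_bigr => i _.
have pascal : 'C(d.+1, i.+1)%:R = 'C(d, i.+1)%:R + 'C(d,
  i)%:R :> K by rewrite binS natrD.
have absorb : i.+1%:R * 'C(d.+1, i.+1)%:R = d.+1%:R * 'C(d, i)%:R :> K.
  by rewrite -!natrM -mul_bin_diag.
rewrite absorb pascal exprS.
have -> : s - i.+1%:R = s - 1 - i%:R by rewrite -natr1; ring.
by ring.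
Qed.

(** Past s = d + 1 the factor d + 1 - s of the recurrence is negative; there the sum has reached its
    constant value, so both claims go through one induction on d. *)
Lemma alt_sum_ge0 d s : 0 <= s ->
  0 <= alt_sum (Num.truncn s).+1 d s /\
  (d%:R <= s -> alt_sum (Num.truncn s).+1 d s = d`!%:R).
Proof.
elim: d s => [|d IH] s s_ge0.
  suff -> : alt_sum (Num.truncn s).+1 0 s = 1 by rewrite ler01.
  rewrite /alt_sum big_nat_recl//= big1 ?addr0 => [|i _];
    last by rewrite bin0n mulr0 mul0r.
  by rewrite bin0 !expr0 !mulr1.
have [IH0 IH1] := IH s s_ge0; rewrite alt_sumS.
(* For s < 1 the argument s - 1 is negative, out of reach of the induction hypothesis, but its sum
   is empty. *)
have [s_lt1|s_ge1] := ltP s 1.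
  have -> : Num.truncn s = 0%N by apply: truncn_def; rewrite s_ge0.
  rewrite {2 4}/alt_sum big_nil mulr0 addr0; split.
    apply: mulr_ge0 => //; move: IH0; suff -> : Num.truncn s = 0%N by [].
    by apply: truncn_def; rewrite s_ge0.
  by move=> /le_lt_trans/(_ s_lt1); rewrite -[1]/(1%:R) ltr_nat.
have s1_ge0 : 0 <= s - 1 by rewrite subr_ge0.
(* This gives the sum at s - 1 exactly the number of terms in the induction hypothesis. *)
have trunc_s1 : (Num.truncn (s - 1)).+1 = Num.truncn s.
  apply/esym/truncn_def; rewrite -!natr1; have /andP[] := truncn_itv s1_ge0.
  by rewrite -natr1 => lo hi; rewrite -lerBrDr lo -ltrBlDr hi.
have [] := IH (s - 1) s1_ge0; rewrite trunc_s1 => IHs0 IHs1.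
have full : d.+1%:R <= s ->
    s * alt_sum (Num.truncn s).+1 d s + (d.+1%:R - s) * alt_sum (Num.truncn s)
      d (s - 1)
      = d.+1`!%:R.
  move=> le_ds; rewrite IH1 ?IHs1; first 1 last.
  - by rewrite lerBrDr natr1.
  - by apply: le_trans le_ds; rewrite ler_nat.
  - by rewrite factS natrM; ring.
split=> //; have [/full->|lt_sd] := leP d.+1%:R s; first exact: ler0n.
by rewrite addr_ge0 ?mulr_ge0// subr_ge0 ltW.
Qed.

Lemma normalizer_ge0 s d : 0 <= s -> 0 <= normalizer s d.
Proof.
move=> s_ge0; suff -> : normalizer s d = alt_sum (Num.truncn s).+1 d s / d`!%:R.
  by rewrite divr_ge0 ?ler0n//; case: (alt_sum_ge0 d s_ge0).
rewrite /normalizer /alt_sum mulr_suml; apply: eq_bigr => i _.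
by rewrite -!mulrA; congr (_ * _); rewrite mulrC mulrA.
Qed.

End Normalizer.

(** * Splitting of the colength, passage to the limit, and the theorem *)

Lemma hs_length_extension (K : realType) (R : comNzRingType) (M : lmodType R)
    (p : nat) (s : K) (m : set R^o) e : submodule m -> p \in [pchar R] ->
  hs_length p s (extension m) (extension m) (idealization R M)^o e.+1 =
  (hs_length p s m m R^o e.+1 + hs_length p s m m M e.+1)%E.
Proof.
move=> sm charR; rewrite !hs_length_ring extension_hs_ideal// hs_lengthE.
apply: rlen_idealization; first exact: submodule_hs_ideal.
  exact: submodule_ideal_mul.
by move=> a x Ha; exact: mem_ideal_mul.
Qed.

Theorem corollary4p4 (K : realType) (R : comNzRingType) (M : lmodType R)
    (p : nat) (s : K) (esRM esR esM : K)
    (noethR : noetherian R) (localR : local_ring R)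
    (charR : p \in [pchar R]) (dimR : (0 < krull_dim R K)%E)
    (fgM : fin_gen M) (s_gt0 : 0 < s)
    (esRM_def : is_es_module p s (idealization R M)^o esRM)
    (esR_def : is_es_module p s R^o esR)
    (esM_def : is_es_module p s M esM) :
  (exists2 esI : K,
     is_es_ideal p s
       (idealization_ideal (max_ideal R) (ideal_mul (max_ideal R) [set: M])) esI &
     esRM <= esI /\ esI = esR + esM) /\
  ((module_dim K M < krull_dim R K)%E -> esRM <= esR).
Proof.
have [d1 [hA [dimA lim_hA ->]]] := esRM_def.
have [d [hR [dimR_d lim_hR ->]]] := esR_def.
have [d2 [hM [dimR_d2 lim_hM ->]]] := esM_def.
(* Each [is_es] hypothesis carries its own dimension; the three are identified. *)
have d1d : d1 = d.
  by move: dimA; rewrite krull_dim_idealization dimR_d => -[/eqP];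
    rewrite eqr_nat => /eqP.
have d2d : d2 = d by move: dimR_d2; rewrite dimR_d => -[/eqP];
  rewrite eqr_nat => /eqP.
subst d1 d2; have p_gt0 : (0 < p)%N by exact/prime_gt0/pcharf_prime/charR.
have norm_ge0 : 0 <= normalizer s d by exact/normalizer_ge0/ltW.
pose lenI e : \bar K := (hs_length p s (extension (M :=
  M) (max_ideal R)) (extension (max_ideal R))
  (idealization R M)^o e * ((p ^ (e * d))%:R^-1)%:E)%E.
have lim_hI : lenI e @[e --> \oo] --> (hR + hM)%:E.
  rewrite EFinD; apply: cvg_trans (cvgeD _ lim_hR lim_hM) => //.
  (* The splitting of lengths is available from e = 1 on, which suffices for the limit. *)
  apply: near_eq_cvg; exists 1%N => // -[//|e] _.
  rewrite /lenI hs_length_extension//; last exact: submodule_max_ideal.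
  by rewrite ge0_muleDl//; exact: hs_length_ge0.
have le_hAI : hA <= hR + hM.
  rewrite -lee_fin; apply: lee_cvg_to lim_hA lim_hI _; apply: nearW => e.
  rewrite /lenI lee_wpmul2r ?lee_fin ?invr_ge0 ?ler0n// !hs_length_ring.
  by apply: rlen_sub => //; exact/hs_idealS/extension_sub_max_ideal.
(* Should the normalizer be 0, both sides are 0 by the convention on inverses. *)
have le_es : hA / normalizer s d <= (hR + hM) / normalizer s d.
  by rewrite ler_wpM2r// invr_ge0.
split.
  exists ((hR + hM) / normalizer s d); last by split; rewrite // mulrDl.
  by exists d, (hR + hM); split; rewrite ?krull_dim_idealization.
(* It remains to show [hM <= 0]. *)
move=> dimM; apply: le_trans le_es _; rewrite ler_wpM2r ?invr_ge0// gerDl.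
have d_gt0 : (0 < d)%N by move: dimR; rewrite dimR_d lte_fin ltr0n.
have [|C leC] := hs_length_growth (K := K) s (d := d.-1) p_gt0 noethR localR fgM.
  by rewrite prednK// -dimR_d.
(* The bound C p^(e (d - 1)) divided by p^(e d) is a geometric sequence of ratio 1 / p. *)
have lim0 : ((C%:R * (p%:R^-1) ^+ e)%:E : \bar K) @[e --> \oo] --> 0%E.
  apply: cvg_EFin; first exact: nearW.
  apply: cvg_geometric; rewrite normfV normr_nat invf_lt1 ?ltr0n// ltr1n.
  exact/prime_gt1/pcharf_prime/charR.
rewrite -lee_fin; apply: lee_cvg_to lim_hM lim0 _; apply: nearW => e.
rewrite lee_pdivrMr ?ltr0n ?expn_gt0 ?p_gt0// -EFinM.
apply: le_trans (leC e) _; rewrite lee_fin.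
have -> : (p ^ (e * d) = (p ^ e) ^ d.-1 * p ^ e)%N by rewrite -expnSr prednK//
  expnM.
rewrite exprVn !natrM !natrX; set q := p%:R ^+ e.
have q_neq0 : q != 0 by rewrite expf_neq0// pnatr_eq0 -lt0n.
by rewrite le_eqVlt; apply/orP; left; apply/eqP; field.
Qed.
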